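(* Let $f:\mathbb{R}^{N}\rightarrow [-\infty ,\infty ]$ be convex. Then: (i) $\sup_{U}f=\operatorname{ess\,sup}_{U}f$ for every density open subset $U\subset \mathbb{R}^{N}$. (ii) $\inf_{U}f=\operatorname{ess\,inf}_{U}f$ for every density open subset $U\subset \mathbb{R}^{N}$ if and only if either $f=\infty$ everywhere, or $\operatorname{dom}f$ has nonempty interior.
   Context: A function $f:\mathbb{R}^N\to[-\infty,\infty]$ is convex if its epigraph $\{(x,t)\in\mathbb{R}^N\times\mathbb{R}: f(x)\leq t\}$ is convex; $f$ is not assumed proper. Its domain is $\operatorname{dom}f:=\{x\in\mathbb{R}^N: f(x)<\infty\}$, which includes the points where $f=-\infty$, if any. Interior refers to the euclidean topology. Measure means Lebesgue measure $\mu_N$ on $\mathbb{R}^N$. A measurable set $E$ has density $1$ at $x$ if $\mu_N(E\cap B(x,r))/\mu_N(B(x,r))\to 1$ as $r\to 0^+$, where $B(x,r)$ is the open euclidean ball with center $x$ and radius $r$. A subset $U\subset\mathbb{R}^N$ is density open if it is empty, or if it is measurable and has density $1$ at each of its points. $\operatorname{ess\,sup}_U f$ and $\operatorname{ess\,inf}_U f$ are taken with respect to $\mu_N$. If $U=\emptyset$, both suprema are $-\infty$ and both infima are $+\infty$. *)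

(* Defs.v *)
From HB Require Import structures.
From mathcomp Require Import all_boot all_order all_algebra.
From mathcomp Require Import all_classical all_reals all_analysis.

Set Implicit Arguments.
Unset Strict Implicit.
Unset Printing Implicit Defensive.

Import Order.TTheory GRing.Theory Num.Theory.
Import numFieldNormedType.Exports.

Local Open Scope classical_set_scope.
Local Open Scope ring_scope.

(* R^N is the type of row vectors 'rV[R]_N.  Its library topology (the one of
   the sup norm) is the euclidean topology, but the library's [ball] is a cube,
   whence the definition of euclidean balls below. *)

Section Lebesgue.
Context {R : realType} {N : nat}.
Local Notation V := 'rV[R]_N.

(* A half-open box ]a, b] is given by its pair of corners.  [None] stands for
   the empty box, which is of the form ]a, b] for every N except N = 0. *)
Definition box (I : option (V * V)) : set V :=
  if I is Some ab
  then [set x | forall i, ab.1 ord0 i < x ord0 i <= ab.2 ord0 i]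
  else set0.

Definition box_volume (I : option (V * V)) : R :=
  if I is Some ab
  then \prod_(i < N) Num.max 0 (ab.2 ord0 i - ab.1 ord0 i)
  else 0.

Local Open Scope ereal_scope.

Definition lebesgue_outer (A : set V) : \bar R :=
  ereal_inf [set \sum_(k <oo) (box_volume (I k))%:E
            | I in [set I : (option (V * V))^nat |
                    A `<=` \bigcup_k box (I k)]].

Lemma box_volume_ge0 I : (0 <= box_volume I)%R.
Proof.
by case: I => [ab|] //=; apply: prodr_ge0 => i _; rewrite le_max lexx.
Qed.

Let vol_ge0 I : 0 <= (box_volume I)%:E.
Proof. by rewrite lee_fin box_volume_ge0. Qed.

Lemma lebesgue_outer_ge0 A : 0 <= lebesgue_outer A.
Proof. by apply: le_ereal_inf_tmp => _ [I _ <-]; exact: nneseries_ge0. Qed.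

Lemma lebesgue_outer0 : lebesgue_outer set0 = 0.
Proof.
apply/eqP; rewrite eq_le lebesgue_outer_ge0 andbT.
by apply: ereal_inf_lbound; exists (fun=> None) => //; exact: eseries0.
Qed.

Lemma le_lebesgue_outer : {homo lebesgue_outer : A B / A `<=` B >-> A <= B}.
Proof.
move=> A B AB; apply: ereal_inf_le_tmp => _ [I BI <-].
by exists I => //; exact: subset_trans AB BI.
Qed.

Lemma lebesgue_outer_sigma_subadditive : sigma_subadditive lebesgue_outer.
Proof.
move=> A; have [[i ioo]|] := pselect (exists i, lebesgue_outer (A i) = +oo).
  rewrite (eseries_pinfty _ _ ioo) ?leey// => n _.
  by rewrite -ltNye (lt_le_trans _ (lebesgue_outer_ge0 _)).
rewrite -forallNE => Aoo.
suff add2e (e : {posnum R}) : lebesgue_outer (\bigcup_n A n) <=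
    \sum_(i <oo) lebesgue_outer (A i) + e%:num%:E.
  by apply/lee_addgt0Pr => _/posnumP[].
rewrite (le_trans _ (epsilon_trick _ _ _))//; last first.
  by move=> n; exact: lebesgue_outer_ge0.
pose P n (B : (option (V * V))^nat) := A n `<=` \bigcup_k box (B k) /\
  \sum_(k <oo) (box_volume (B k))%:E <=
  lebesgue_outer (A n) + (e%:num / (2 ^ n.+1)%:R)%:E.
have [G PG] : {G : ((option (V * V))^nat)^nat & forall n, P n (G n)}.
  apply: (@choice _ _ P) => n; rewrite /P.
  have fA : lebesgue_outer (A n) \is a fin_num.
    by rewrite ge0_fin_numE ?lebesgue_outer_ge0// ltey; exact/eqP.
  have en1 : (0 < e%:num / (2 ^ n.+1)%:R)%R by [].
  have [_ [B AB <-] /ltW] := lb_ereal_inf_adherent en1 fA.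
  by exists B.
pose v (ij : nat * nat) := (box_volume (uncurry G ij))%:E.
have v_ge0 ij : 0 <= v ij by exact: vol_ge0.
apply: (@le_trans _ _ (\esum_(i in setT) v i)).
  apply: ereal_inf_lbound => /=.
  have /card_esym/ppcard_eqP[f] := card_nat2.
  exists (uncurry G \o f).
    apply: (@subset_trans _  (\bigcup_n \bigcup_k box (G n k))) => [t [i _]|].
      by move=> /((PG i).1) -[j _ ?]; exists i => //; exists j.
    move=> t [i _ [j _ Bijt]]; exists (f^-1%FUN (i, j)) => //=.
    by rewrite invK ?inE.
  rewrite -(esum_pred_image v _ xpredT) ?[fun=> _]set_true//.
  by rewrite image_eq.
rewrite (_ : esum _ _ =
    \sum_(i <oo) \sum_(j <oo ) (box_volume (G i j))%:E); last first.
  pose J : nat -> set (nat * nat) := fun i => [set (i, j) | j in setT].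
  rewrite (_ : setT = \bigcup_k J k); last first.
    by rewrite predeqE => -[a b]; split => // _; exists a => //; exists b.
  rewrite esum_bigcupT /=; last 2 first.
    - apply/trivIsetP => i j _ _ ij.
      rewrite predeqE => -[n m] /=; split => //= -[] [_] _ [<-{n} _].
      by move=> [m' _] [] /esym/eqP; rewrite (negbTE ij).
    - by move=> /= [n m]; exact: v_ge0.
  rewrite -(image_id [set: nat]) -fun_true esum_pred_image//; last first.
    by move=> n _; exact: esum_ge0.
  apply: eq_eseriesr => /= j _.
  rewrite -(esum_pred_image v (pair j) predT)//=; last first.
    by move=> ? ? _ _; exact: (@can_inj _ _ _ snd).
  by congr esum; rewrite predeqE => -[a b]; split; move=> [i _ <-]; exists i.
apply: lee_lim.
- apply: is_cvg_nneseries => n *.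
  by apply: nneseries_ge0 => m *; exact: vol_ge0.
- apply: is_cvg_nneseries => n *; apply: adde_ge0 => //.
  exact: lebesgue_outer_ge0.
- by near=> n; apply: lee_sum => i _; exact: (PG i).2.
Unshelve. all: by end_near. Qed.

HB.instance Definition _ := isOuterMeasure.Build R V lebesgue_outer
  lebesgue_outer0 lebesgue_outer_ge0 le_lebesgue_outer
  lebesgue_outer_sigma_subadditive.

(* Lebesgue measure on the sigma-algebra of the Lebesgue (i.e. Caratheodory)
   measurable sets; it is complete. *)
Definition lebesgue_mu : set (caratheodory_type lebesgue_outer) -> \bar R :=
  lebesgue_outer.

HB.instance Definition _ := isMeasure.Build _ _ _ lebesgue_mu
  (caratheodory_measure0 lebesgue_outer)
  (caratheodory_measure_ge0 (mu := lebesgue_outer))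
  (caratheodory_measure_sigma_additive (mu := lebesgue_outer)).

End Lebesgue.

Section Definitions.
Context {R : realType} {N : nat}.
Local Notation V := 'rV[R]_N.
Local Notation mu := (@lebesgue_mu R N).
Local Notation L := (caratheodory_type (@lebesgue_outer R N)).
Implicit Types (f : V -> \bar R) (U E : set V) (x : V) (r : R).

Definition eball x r : set V :=
  [set y | Num.sqrt (\sum_(i < N) (y ord0 i - x ord0 i) ^+ 2) < r].

Local Open Scope ereal_scope.

Definition density1 E x :=
  mu (E `&` eball x r) / mu (eball x r) @[r --> 0^'+] --> 1.

Definition density_open U :=
  U = set0 \/
  lebesgue_outer.-cara.-measurable U /\ (forall x, U x -> density1 U x).

Definition epigraph f : set (V * R^o) := [set p | f p.1 <= p.2%:E].

Definition convex_efun f := convex_set (epigraph f).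

Definition edom f : set V := [set x | f x < +oo].

(* Essential bounds over U: the library's [ess_sup] and [ess_inf], with the
   almost everywhere bounds required on U only.  They are -oo and +oo when U is
   empty. *)
Definition ess_sup_on U f : \bar R :=
  ereal_inf [set y | {ae mu, forall x : L, U x -> f x <= y}].

Definition ess_inf_on U f : \bar R :=
  ereal_sup [set y | {ae mu, forall x : L, U x -> y <= f x}].

End Definitions.

(* Main.v *)
Require Import Defs.
From mathcomp Require Import all_boot all_order all_algebra.
From mathcomp Require Import all_classical all_reals all_analysis.
From mathcomp Require Import measurable_realfun.
From mathcomp Require Import ring lra.
Import Order.TTheory GRing.Theory Num.Theory.
Import numFieldNormedType.Exports.
Local Open Scope classical_set_scope.
Local Open Scope ring_scope.

(** The two parts come from one fact about density points
    ([density1_meets]): if [U] has density 1 at [x] then, for all small [r], a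
    subset of the ball [B(x, r)] filling at least a fixed proportion of it
    cannot miss [U] up to a null set.  In both parts one inequality is trivial
    and the other one says that a value of [f] at a point of [U] is seen on a
    subset of [U] of positive measure.

    For suprema, let [f <= y] almost everywhere on [U] and let [x] be in [U].
    The sublevel set [f <= y] is convex and contains almost all of [U].  Near
    [x], both [U] and its reflection through [x] fill more than half of the
    ball, so that some [z] and its mirror image [2x - z] both lie in the
    sublevel set, which therefore contains their midpoint [x]
    ([convex_set_density_point]).

    For infima, let [dom f] have positive measure, and let [x] in [U] satisfy
    [f x < y].  Some bounded set [A] of positive measure carries a finite upper
    bound of [f], and by convexity [f < y] on [x + t (A - x)] for every small
    [t].  These homothetic copies fill a fixed proportion of the balls around
    [x], hence [f < y] on a part of [U] of positive measure
    ([convex_sublevel_density_point]).  If on the contrary [dom f] is null and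
    not empty, then the whole space has essential infimum [+oo] and a smaller
    infimum.  It remains that a convex set is null if and only if its interior
    is empty: if it does not contain the vertices of a nondegenerate simplex,
    it lies in a hyperplane ([convex_set_null]).

    The measure theory needed is the behaviour of the outer measure under
    homotheties and reflections, the positivity of the measure of balls, and
    the nullity of hyperplanes.  Positivity comes from the lower bound for the
    measure of a box ([le_box_volume_cover]), which is proved by induction on
    the dimension, slicing a cover and integrating the volumes of the slices as
    in the principle of Cavalieri. *)

(** * The outer measure: covers, null sets, homotheties *)
Section OuterMeasure.
Context {R : realType} {N : nat}.
Local Notation V := 'rV[R]_N.
Local Notation outer := (@lebesgue_outer R N).
Implicit Types (A B : set V) (I : option (V * V)).
Local Open Scope ereal_scope.

Let vol_ge0 I : 0 <= (box_volume I)%:E.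
Proof. by rewrite lee_fin box_volume_ge0. Qed.

Lemma le_lebesgue_outer_cover A (J : (option (V * V))^nat) :
  A `<=` \bigcup_k box (J k) -> outer A <= \sum_(k <oo) (box_volume (J k))%:E.
Proof. by move=> AJ; apply: ereal_inf_lbound; exists J. Qed.

Lemma lebesgue_outer_ge A c :
  (forall J : (option (V * V))^nat, A `<=` \bigcup_k box (J k) ->
    c <= \sum_(k <oo) (box_volume (J k))%:E) ->
  c <= outer A.
Proof. by move=> cJ; apply: le_ereal_inf_tmp => _ [J AJ <-]; exact: cJ. Qed.

Lemma lebesgue_outer_box_le I : outer (box I) <= (box_volume I)%:E.
Proof.
pose J (k : nat) : option (V * V) := if k is 0%N then I else None.
have /le_trans : outer (box I) <= \sum_(k <oo) (box_volume (J k))%:E.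
  by apply: le_lebesgue_outer_cover => x Ix; exists 0%N.
apply; rewrite nneseries_recl// eseries0 ?adde0// => -[|i] //.
Qed.

Lemma lebesgue_outer_null_bigcup (Z : (set V)^nat) :
  (forall k, outer (Z k) = 0) -> outer (\bigcup_k Z k) = 0.
Proof.
move=> Z0; apply/eqP; rewrite eq_le lebesgue_outer_ge0 andbT.
apply: le_trans (outer_measure_sigma_subadditive outer Z) _.
by rewrite eseries0// => k _ _; exact: Z0.
Qed.

Lemma lebesgue_outer_setU_null A B : outer B = 0 -> outer (A `|` B) = outer A.
Proof.
move=> B0; apply/eqP; rewrite eq_le; apply/andP; split.
  by rewrite -[leRHS]adde0 -B0; exact: outer_measureU2.
by apply: le_lebesgue_outer; exact: subsetUl.
Qed.

Lemma lebesgue_outer_subset_null A B : A `<=` B -> outer B = 0 -> outer A = 0.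
Proof.
move=> AB B0; apply/eqP; rewrite eq_le lebesgue_outer_ge0 andbT -B0.
exact: le_lebesgue_outer.
Qed.

(** The common part of the computations of the measure of a homothetic and of
    a reflected set: pulling a cover of [A] back along [g] gives a cover by
    boxes [phi I].  The null sets [Z I] allow for a [g] that reverses the
    coordinates, as it exchanges the open and the closed faces of a box. *)
Lemma lebesgue_outer_preimage (g : V -> V) (phi : option (V * V) -> option (V * V))
    (Z : option (V * V) -> set V) (c : R) A :
  (0 < c)%R ->
  (forall I, g @^-1` box I `<=` box (phi I) `|` Z I) ->
  (forall I, outer (Z I) = 0) ->
  (forall I, box_volume (phi I) <= c * box_volume I)%R ->
  outer (g @^-1` A) <= c%:E * outer A.
Proof.
move=> c0 gbox Z0 volphi; rewrite muleC -lee_pdivrMr//.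
apply: lebesgue_outer_ge => J AJ; rewrite lee_pdivrMr// muleC.
have gA : g @^-1` A `<=` \bigcup_k box (phi (J k)) `|` \bigcup_k Z (J k).
  by move=> x /AJ[k _ /gbox[?|?]]; [left|right]; exists k.
apply: le_trans (le_lebesgue_outer gA) _.
rewrite lebesgue_outer_setU_null; last exact: lebesgue_outer_null_bigcup.
apply: (@le_trans _ _ (\sum_(k <oo) (box_volume (phi (J k)))%:E)).
  exact: le_lebesgue_outer_cover.
rewrite -nneseriesZl; last by move=> *; exact: vol_ge0.
by apply: lee_nneseries => k *; rewrite -?EFinM ?lee_fin ?volphi ?box_volume_ge0.
Qed.

Let lebesgue_outer_affine_le (w : V) (t : R) A (t0 : (0 < t)%R) :
  outer [set (w + t *: z)%R | z in A] <= (t ^+ N)%:E * outer A.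
Proof.
pose phi I : option (V * V) :=
  if I is Some ab then Some (w + t *: ab.1, w + t *: ab.2)%R else None.
have -> : [set (w + t *: z)%R | z in A] = (fun y => t^-1 *: (y - w))%R @^-1` A.
  apply/seteqP; split=> [_ [z Az <-]|y Ay] /=.
    by rewrite addrC addKr scalerA mulVf ?gt_eqF// scale1r.
  exists (t^-1 *: (y - w))%R => //.
  by rewrite scalerA divff ?gt_eqF// scale1r addrCA subrr addr0.
apply: (@lebesgue_outer_preimage _ phi (fun=> set0)) => //.
- by rewrite exprn_gt0.
- move=> [[a b]|]//= y yab; left => i; have := yab i.
  rewrite /= !mxE => /andP[].
  by rewrite ltr_pdivlMl// ler_pdivrMl// ltrBrDl lerBlDl => -> ->.
- move=> [[a b]|]/=; last by rewrite mulr0.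
  rewrite -[in (t ^+ N)%R](card_ord N) -prodr_const -big_split/= ler_prod// => i _.
  rewrite le_max lexx/= !mxE (maxr_pMr _ _ (ltW t0)) mulr0.
  by have -> : (w ord0 i + t * b ord0 i - (w ord0 i + t * a ord0 i) =
    t * (b ord0 i - a ord0 i))%R by ring.
Qed.

Lemma lebesgue_outer_affine (w : V) (t : R) A : (0 < t)%R ->
  outer [set (w + t *: z)%R | z in A] = (t ^+ N)%:E * outer A.
Proof.
move=> t0.
(* The converse inequality is the first one for the inverse homothety. *)
apply/eqP; rewrite eq_le lebesgue_outer_affine_le//=.
rewrite muleC -lee_pdivlMr ?exprn_gt0// muleC -exprVn.
have t'0 : (0 < t^-1)%R by rewrite invr_gt0.
have := @lebesgue_outer_affine_le (- (t^-1 *: w))%R t^-1 [set (w + t *: z)%R | z in A] t'0.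
apply: le_trans; apply: le_lebesgue_outer => z Az /=.
exists (w + t *: z)%R; first by exists z.
by rewrite scalerDr addKr scalerA mulVf ?gt_eqF// scale1r.
Qed.

Lemma lebesgue_outer_translate (w : V) A : outer [set (w + z)%R | z in A] = outer A.
Proof.
transitivity (outer [set (w + 1 *: z)%R | z in A]).
  by congr outer; apply: eq_imagel => z _; rewrite scale1r.
by rewrite lebesgue_outer_affine// expr1n mul1e.
Qed.

End OuterMeasure.

(** * The measure of a box *)
Section BoxVolume.
Context {R : realType}.
Local Open Scope ereal_scope.

Let tail {n} (a : 'rV[R]_n.+1) : 'rV[R]_n := \row_j a ord0 (lift ord0 j).

Let box_slice {n} (t : R) (I : option ('rV[R]_n.+1 * 'rV[R]_n.+1)) :
    option ('rV[R]_n * 'rV[R]_n) :=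
  if I is Some ab then
    if (ab.1 ord0 ord0 < t <= ab.2 ord0 ord0)%R then Some (tail ab.1, tail ab.2)
    else None
  else None.

Let box_volumeS n (a b : 'rV[R]_n.+1) : box_volume (Some (a, b)) =
  (Num.max 0 (b ord0 ord0 - a ord0 ord0) *
   box_volume (Some (tail a, tail b)))%R.
Proof.
rewrite /= big_ord_recl; congr (_ * _)%R.
by apply: eq_bigr => j _; rewrite !mxE.
Qed.

Let lebesgue_measure_itvoc (x y : R) :
  lebesgue_measure `]x, y] = (Num.max 0 (y - x))%:E.
Proof.
rewrite lebesgue_measure_itv/= lte_fin -EFinB -(subr_gt0 x y).
by case: ltP => //.
Qed.

(** As a function of the height [t], the volume of the slice of a box is a
    multiple of the indicator function of an interval, whose integral is the
    volume of the box. *)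
Let box_slice_volumeE {n} I : exists (J : set R) (v : R),
  [/\ measurable J, (0 <= v)%R,
   forall t, box_volume (@box_slice n t I) = (v * \1_J t)%R &
   v%:E * lebesgue_measure J = (box_volume I)%:E].
Proof.
case: I => [[a b]|]; last first.
  by exists set0, 0%R; split => // [t|]; rewrite ?mul0r// mul0e.
exists `]a ord0 ord0, b ord0 ord0]%classic, (box_volume (Some (tail a, tail b))).
split => //; first exact: box_volume_ge0.
- move=> t; rewrite indicE mem_setE in_itv/= /box_slice/=.
  by case: ifPn => _; rewrite ?mulr1 ?mulr0.
- by rewrite lebesgue_measure_itvoc box_volumeS -EFinM mulrC.
Qed.

(** Induction on the dimension: at every height in the first side of the box,
    the slices of the covering boxes cover the slice of the box.  Integrating
    the resulting inequality over that side gives the claim, as sum and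
    integral commute for nonnegative functions. *)
Lemma le_box_volume_cover n (a b : 'rV[R]_n)
    (I : (option ('rV[R]_n * 'rV[R]_n))^nat) :
  box (Some (a, b)) `<=` \bigcup_k box (I k) ->
  (box_volume (Some (a, b)))%:E <= \sum_(k <oo) (box_volume (I k))%:E.
Proof.
elim: n a b I => [|n IHn] a b I abI.
  (* In dimension 0 every nonempty box is the one-point space, of volume 1. *)
  have /abI[k _ Ik] : box (Some (a, b)) (0%R : 'rV[R]_0) by case.
  apply: (@le_trans _ _ (box_volume (I k))%:E).
    by rewrite /= big_ord0; case: (I k) Ik => //= ab _; rewrite big_ord0.
  rewrite (@nneseriesD1 _ _ k)//; last by move=> *; rewrite lee_fin box_volume_ge0.
  rewrite leeDl// nneseries_ge0// => *; first by rewrite lee_fin box_volume_ge0.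
have [J /choice[v JvP]] := choice (fun k => box_slice_volumeE (I k)).
pose D := `]a ord0 ord0, b ord0 ord0]%classic.
pose f (k : nat) (t : R) : \bar R := (v k * \1_(J k) t)%:E.
have mD : measurable D by exact: measurable_itv.
have mf k : measurable_fun D (f k).
  apply/measurable_EFinP; apply: measurable_funM => //.
  by have [mJ _ _ _] := JvP k; exact: measurable_indic.
have f0 k (t : R) : 0 <= f k t.
  by have [_ v0 _ _] := JvP k; rewrite lee_fin mulr_ge0.
rewrite box_volumeS mulrC EFinM -lebesgue_measure_itvoc -/D.
rewrite -(integral_cst lebesgue_measure)//.
apply: (@le_trans _ _ (\int[lebesgue_measure]_(t in D)
    \sum_(k <oo) f k t)).
  apply: ge0_le_integral => //.
  - by move=> t _; rewrite /cst lee_fin box_volume_ge0.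
  - by apply: ge0_emeasurable_sum => k; [move=> t _ _; exact: f0|move=> _; exact: mf].
  - move=> t Dt; rewrite (@eq_eseriesr _ _ (fun k => (box_volume (box_slice t (I k)))%:E)).
      apply: IHn => y yab.
      pose x : 'rV[R]_n.+1 := \row_i (if unlift ord0 i is Some j then y ord0 j else t).
      have x0 : x ord0 ord0 = t by rewrite mxE unlift_none.
      have xS j : x ord0 (lift ord0 j) = y ord0 j by rewrite mxE liftK.
      have /abI[k _ Ikx] : box (Some (a, b)) x.
        move=> i; case: (unliftP ord0 i) => [j|] ->; rewrite ?x0 ?xS.
          by have := yab j; rewrite /= !mxE.
        by move: Dt; rewrite /D/= in_itv.
      exists k => //; case: (I k) Ikx => //= cd cdx.
      have := cdx ord0; rewrite x0 => ->.
      by move=> j /=; have := cdx (lift ord0 j); rewrite xS !mxE.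
    by move=> k _; have [_ _ -> _] := JvP k.
rewrite integral_nneseries//.
apply: lee_nneseries => k *; first by apply: integral_ge0 => t _; exact: f0.
have [mJ v0 _ <-] := JvP k.
under eq_integral do rewrite /f EFinM.
rewrite ge0_integralZl_EFin//; last first.
  by apply/measurable_EFinP; exact: measurable_indic.
rewrite integral_indic//; apply: lee_pmul => //; rewrite ?lee_fin//.
by apply: le_measure; rewrite ?inE//; exact: measurableI.
Qed.

Lemma lebesgue_outer_box n (I : option ('rV[R]_n * 'rV[R]_n)) :
  lebesgue_outer (box I) = (box_volume I)%:E.
Proof.
case: I => [[a b]|]; last exact: lebesgue_outer0.
apply/eqP; rewrite eq_le lebesgue_outer_box_le/=.
by apply: lebesgue_outer_ge => J; exact: le_box_volume_cover.
Qed.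

End BoxVolume.

(** * Hyperplanes are null *)
Section Hyperplanes.
Context {R : realType} {N : nat}.
Local Notation V := 'rV[R]_N.
Local Notation outer := (@lebesgue_outer R N).
Local Notation L := (caratheodory_type (@lebesgue_outer R N)).
Implicit Types (A B : set V) (I : option (V * V)).
Local Open Scope ereal_scope.

Let box_cut_below (i : 'I_N) (c : R) I : option (V * V) :=
  if I is Some ab then
    Some (ab.1, \row_j if j == i then Num.min (ab.2 ord0 j) c else ab.2 ord0 j)%R
  else None.

Let box_cut_above (i : 'I_N) (c : R) I : option (V * V) :=
  if I is Some ab then
    Some (\row_j if j == i then Num.max (ab.1 ord0 j) c else ab.1 ord0 j, ab.2)%R
  else None.

Let box_cut_volume i c I :
  (box_volume (box_cut_below i c I) + box_volume (box_cut_above i c I) =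
   box_volume I)%R.
Proof.
case: I => [[a b]|]/=; last by rewrite addr0.
rewrite (bigD1 i)//= [X in (_ + X)%R](bigD1 i)//= [RHS](bigD1 i)//= !mxE eqxx.
pose P := (\prod_(j < N | j != i) Num.max 0 (b ord0 j - a ord0 j))%R.
rewrite [X in (_ * X + _)%R](_ : _ = P); last first.
  by apply: eq_bigr => j /negPf ji; rewrite !mxE ji.
rewrite [X in (_ + _ * X)%R](_ : _ = P); last first.
  by apply: eq_bigr => j /negPf ji; rewrite !mxE ji.
rewrite -mulrDl; congr (_ * _)%R.
rewrite /Num.max /Num.min; do !case: ifPn; rewrite -?leNgt; lra.
Qed.

(** The hyperplane [x_i = c] cuts every box into two boxes whose volumes add up
    to the volume of the box, so that it cuts every cover accordingly. *)
Lemma measurable_coord_gt (i : 'I_N) (c : R) :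
  lebesgue_outer.-cara.-measurable [set x : V | (c < x ord0 i)%R].
Proof.
apply: le_caratheodory_measurable => X /=.
apply: lebesgue_outer_ge => J XJ.
under eq_eseriesr do rewrite -(box_cut_volume i c) EFinD.
rewrite nneseriesD; try by move=> *; rewrite lee_fin box_volume_ge0.
rewrite addeC; apply: leeD; apply: le_lebesgue_outer_cover => x [/XJ[k _ Jx] /= xc];
    exists k => //; case: (J k) Jx => //= -[a b] abx j /=; rewrite !mxE.
- case: eqP => [->|_]; last exact: abx.
  rewrite le_min; have /= /andP[-> ->] := abx i.
  by rewrite leNgt; exact/negP.
- case: eqP => [->|_]; last exact: abx.
  by rewrite gt_max; have /= /andP[-> ->] := abx i; rewrite xc.
Qed.

Lemma measurable_coord (i : 'I_N) :
  measurable_fun [set: L] (fun x : L => (x : V) ord0 i).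
Proof.
apply: (measurability _ (RGenOInfty.measurableE R)) => _ [_ [c ->] <-].
rewrite setTI; suff -> : (fun x : L => (x : V) ord0 i) @^-1` `]c, +oo[ =
    [set x : V | (c < x ord0 i)%R] by exact: measurable_coord_gt.
by apply/seteqP; split => x /=; rewrite in_itv/= andbT.
Qed.

Lemma measurable_hyperplane (a : 'cV[R]_N) (c : R) :
  lebesgue_outer.-cara.-measurable [set x : V | (x *m a) ord0 ord0 = c].
Proof.
have mphi : measurable_fun [set: L]
    (fun x : L => \sum_(i < N) (x : V) ord0 i * a i ord0)%R.
  apply: measurable_sum => i; apply: measurable_funM; first exact: measurable_coord.
  exact: measurable_cst.
have := mphi measurableT [set c] (measurable_set1 c); rewrite setTI.
by congr measurable; apply/seteqP; split => x /=; rewrite mxE.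
Qed.

(** Infinitely many translates of a bounded piece of the hyperplane lie in
    disjoint measurable sets, the parallel hyperplanes, and in one box of finite
    measure; as they all have the same measure, it is zero. *)
Lemma lebesgue_outer_hyperplane (a : 'cV[R]_N) (c : R) : a != 0%R ->
  outer [set x : V | (x *m a) ord0 ord0 = c] = 0.
Proof.
move=> /cV0Pn[i ai0].
pose v : V := ((a i ord0)^-1 *: delta_mx ord0 i)%R.
have va : (v *m a) ord0 ord0 = 1%R.
  rewrite mxE (bigD1 i)//= big1 ?addr0 => [|j /negPf ji].
    by rewrite !mxE !eqxx mulr1 mulVf.
  by rewrite !mxE ji andbF mulr0 mul0r.
pose H (s : R) := [set x : V | (x *m a) ord0 ord0 = s].
pose Q (m : R) := box (Some (const_mx (- m), const_mx m : V))%R.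
have HQ : H c `<=` \bigcup_k (Q k%:R `&` H c).
  move=> x Hx; pose S := (\sum_j `|x ord0 j| + 1)%R.
  have [k Sk] : exists k, (S < k%:R)%R.
    by exists (Num.truncn S).+1; rewrite truncnS_gt.
  exists k => //; split => // j /=; rewrite !mxE.
  have : (`|x ord0 j| < k%:R)%R.
    apply: le_lt_trans Sk; rewrite /S (bigD1 j)//= -addrA lerDl addr_ge0//.
    exact: sumr_ge0.
  by rewrite ltr_norml => /andP[-> /ltW].
apply: lebesgue_outer_subset_null HQ _; apply: lebesgue_outer_null_bigcup => m /=.
(* Moving by [v / (k + 1)], where [a] takes the value 1 at [v], sends [H c] to
   [A k], and moves coordinates by at most [`|v_i|]. *)
pose A (k : nat) := H (c + k.+1%:R^-1)%R.
have mA k : lebesgue_outer.-cara.-measurable (A k) by exact: measurable_hyperplane.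
have tA : trivIset setT A.
  move=> j k _ _ [x []]; rewrite /A /H /= => -> /addrI/invr_inj/eqP.
  by rewrite eqr_nat => /eqP[].
pose M := (m%:R + `|v ord0 i|)%R.
have QA k : outer (Q m%:R `&` H c) <= outer (Q M `&` A k).
  rewrite -(lebesgue_outer_translate (k.+1%:R^-1 *: v)%R).
  apply: le_lebesgue_outer => _ [x [Qx Hx] <-]; split; last first.
    by rewrite /A /H /= mulmxDl -scalemxAl mxE [X in (X + _)%R]mxE va mulr1 addrC Hx.
  move=> j; have /= := Qx j; rewrite !mxE => /andP[x1 x2].
  have : (`|k.+1%:R^-1 * v ord0 j| <= `|v ord0 i|)%R.
    rewrite normrM ger0_norm// mulrC; apply: (@le_trans _ _ `|v ord0 j|%R).
      by rewrite ler_piMr// invf_le1// ler1n.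
    have [->//|ji] := eqVneq j i.
    by rewrite !mxE (negPf ji) andbF mulr0 normr0.
  rewrite !mxE ler_norml => /andP[].
  rewrite /M !mxE; set t := (_ * (_ * _))%R; set u := `|_|%R.
  by move=> t1 t2; apply/andP; split; lra.
have Qfin : outer (Q M) < +oo.
  exact: le_lt_trans (lebesgue_outer_box_le _) (ltry _).
apply/eqP; rewrite eq_le lebesgue_outer_ge0 andbT leNgt; apply/negP => QH0.
have nQ n : outer (Q m%:R `&` H c) *+ n <= outer (Q M).
  apply: (@le_trans _ _ (outer (Q M `&` \big[setU/set0]_(k < n) A k))); last first.
    by apply: le_lebesgue_outer; exact: subIsetl.
  rewrite (caratheodory_additive mA tA n (Q M)).
  have -> : outer (Q m%:R `&` H c) *+ n = \sum_(k < n) outer (Q m%:R `&` H c).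
    by rewrite sumr_const card_ord.
  by apply: lee_sum => k _; exact: QA.
have Hfin : outer (Q m%:R `&` H c) \is a fin_num.
  rewrite ge0_fin_numE ?lebesgue_outer_ge0//; apply: le_lt_trans Qfin.
  apply: le_trans (QA 0%N) _; apply: le_lebesgue_outer; exact: subIsetl.
move: Hfin QH0 nQ Qfin.
case: (outer (Q m%:R `&` H c)) => // e _; rewrite lte_fin => e0 nQ.
case: (outer (Q M)) nQ => [q nQ _|//|/(_ 0%N)]; last by rewrite mule0n.
have := nQ (Num.truncn (q / e)).+1.
rewrite -EFin_natmul lee_fin leNgt -mulr_natl -ltr_pdivrMr//.
by rewrite truncnS_gt.
Qed.

End Hyperplanes.

(** * Reflections, balls and density points *)
Section Balls.
Context {R : realType} {N : nat}.
Local Notation V := 'rV[R]_N.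
Local Notation outer := (@lebesgue_outer R N).
Implicit Types (A S U : set V) (x w : V).

Let lebesgue_outer_reflect_le w A :
  (outer [set (w - z)%R | z in A] <= outer A)%E.
Proof.
pose phi (I : option (V * V)) : option (V * V) :=
  if I is Some ab then Some (w - ab.2, w - ab.1) else None.
pose Z (I : option (V * V)) : set V :=
  if I is Some ab then
    \big[setU/set0]_(i < N)
      [set y : V | (y *m (delta_mx i ord0 : 'cV[R]_N)) ord0 ord0 = w ord0 i - ab.2 ord0 i]
  else set0.
have -> : [set w - z | z in A] = (fun y => w - y) @^-1` A.
  apply/seteqP; split=> [_ [z Az <-]|y Ay] /=; first by rewrite subKr.
  by exists (w - y) => //; rewrite subKr.
rewrite -[leRHS]mul1e; apply: (@lebesgue_outer_preimage _ _ _ phi Z) => //.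
- move=> [[a b]|]//= y yab.
  have [Zy|Zy] := pselect (Z (Some (a, b)) y); [by right|left].
  move=> i /=; have := yab i; rewrite !mxE /= => /andP[ay yb].
  apply/andP; split; last by lra.
  (* Here [y] could be on the face which the reflection has opened. *)
  rewrite lt_neqAle; apply/andP; split; last by lra.
  apply/eqP => E; apply: Zy.
  by rewrite /Z (bigD1 i)//=; left; rewrite /= -colE mxE E.
- move=> [[a b]|]/=; last exact: lebesgue_outer0.
  elim/big_ind : _ => [|S1 S2 S10 S20|i _].
  + exact: lebesgue_outer0.
  + by rewrite lebesgue_outer_setU_null.
  + apply: lebesgue_outer_hyperplane; apply/cV0Pn; exists i.
    by rewrite mxE !eqxx oner_eq0.
- move=> [[a b]|]/=; last by rewrite mulr0.
  rewrite mul1r ler_prod// => i _; rewrite le_max lexx/= !mxE.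
  by have -> : w ord0 i - a ord0 i - (w ord0 i - b ord0 i) = b ord0 i - a ord0 i by ring.
Qed.

(** The reflection of a half-open box is half-open on the other side; the two
    differ by pieces of hyperplanes. *)
Lemma lebesgue_outer_reflect w A : outer [set (w - z)%R | z in A] = outer A.
Proof.
apply/eqP; rewrite eq_le lebesgue_outer_reflect_le/=.
apply: le_trans (lebesgue_outer_reflect_le w [set w - z | z in A]).
apply: le_lebesgue_outer => z Az; exists (w - z); last by rewrite subKr.
by exists z.
Qed.

Lemma eballP {x} {r : R} {y : V} : 0 < r ->
  eball x r y <-> \sum_(i < N) (y ord0 i - x ord0 i) ^+ 2 < r ^+ 2.
Proof.
move=> r0; rewrite /eball/=.
by rewrite -[in X in (X <-> _)](ger0_norm (ltW r0)) -sqrtr_sqr ltr_sqrt// exprn_gt0.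
Qed.

Lemma eball_scale x (t r : R) : 0 < t -> 0 < r ->
  eball x (t * r) = [set (x - t *: x) + t *: z | z in eball x r].
Proof.
move=> t0 r0; have tr0 : 0 < t * r by rewrite mulr_gt0.
have sumE (z : V) : \sum_(i < N) (((x - t *: x) + t *: z) ord0 i - x ord0 i) ^+ 2 =
    t ^+ 2 * \sum_(i < N) (z ord0 i - x ord0 i) ^+ 2.
  by rewrite mulr_sumr; apply: eq_bigr => i _; rewrite !mxE; ring.
apply/seteqP; split=> [y /(eballP tr0)|_ [z /(eballP r0) zr <-]]; last first.
  by apply/eballP => //; rewrite sumE exprMn ltr_pM2l// exprn_gt0.
pose z := t^-1 *: (y - (x - t *: x)).
have -> : y = (x - t *: x) + t *: z.
  by rewrite scalerA divff ?gt_eqF// scale1r addrCA subrr addr0.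
rewrite sumE exprMn ltr_pM2l ?exprn_gt0// => zr.
by exists z => //; exact/eballP.
Qed.

Lemma lebesgue_outer_eball_scale x (t r : R) : 0 < t -> 0 < r ->
  outer (eball x (t * r)) = ((t ^+ N)%:E * outer (eball x r))%E.
Proof. by move=> t0 r0; rewrite eball_scale// lebesgue_outer_affine. Qed.

Lemma lebesgue_outer_cube_gt0 x (e : R) : 0 < e ->
  (0 < outer (box (Some (x - const_mx e, x + const_mx e)%R)))%E.
Proof.
move=> e0; rewrite lebesgue_outer_box lte_fin/= prodr_gt0// => i _.
by rewrite !mxE lt_max; apply/orP; right; lra.
Qed.

Lemma lebesgue_outer_eball_gt0 x (r : R) : 0 < r -> (0 < outer (eball x r))%E.
Proof.
move=> r0.
(* The cube of half-side [e] lies in the ball, as [N * e ^+ 2 < r ^+ 2]. *)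
pose e := r / N.+1%:R.
have e0 : 0 < e by rewrite divr_gt0.
apply: lt_le_trans (lebesgue_outer_cube_gt0 x _ e0) _.
apply: le_lebesgue_outer => y yxe; apply/eballP => //.
apply: (@le_lt_trans _ _ (\sum_(i < N) e ^+ 2)).
  apply: ler_sum => i _; have := yxe i; rewrite !mxE => /andP[y1 y2].
  by rewrite -ler_sqrt ?exprn_ge0 ?(ltW e0)// !sqrtr_sqr (gtr0_norm e0) ler_norml; lra.
rewrite sumr_const card_ord -mulr_natl /e exprMn mulrCA gtr_pMr ?exprn_gt0//.
rewrite exprVn expr2 ltr_pdivrMr ?mulr_gt0// mul1r -natrM ltr_nat.
by rewrite mulSn; apply: ltn_addr.
Qed.

Lemma lebesgue_outer_eball_lty x (r : R) : (outer (eball x r) < +oo)%E.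
Proof.
have [r0|r0] := ltP 0 r; last first.
  rewrite (_ : eball x r = set0) ?lebesgue_outer0 ?ltry//.
  apply/seteqP; split => // y; rewrite /eball/= ltNge => /negP; apply.
  exact: le_trans r0 (sqrtr_ge0 _).
suff : eball x r `<=` box (Some (x - const_mx r, x + const_mx r)).
  move=> /le_lebesgue_outer/le_lt_trans; apply.
  by rewrite lebesgue_outer_box ltry.
move=> y /(eballP r0) yr i /=; rewrite !mxE.
have : `|y ord0 i - x ord0 i| < r.
  rewrite -[ltRHS](ger0_norm (ltW r0)) -!sqrtr_sqr ltr_sqrt ?exprn_gt0//.
  apply: le_lt_trans yr; rewrite (bigD1 i)//= lerDl.
  by apply: sumr_ge0 => j _; exact: sqr_ge0.
by rewrite ltr_norml; lra.
Qed.

Lemma lebesgue_outer_eball_fin_num x (r : R) : outer (eball x r) \is a fin_num.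
Proof. by rewrite ge0_fin_numE ?lebesgue_outer_ge0// lebesgue_outer_eball_lty. Qed.

(** A set [S] that fills a proportion [c] of the ball and misses [U] up to a
    null set would leave to [U] at most the proportion [1 - c] of the ball.  As
    [S] may depend on [r], it is quantified after the radius. *)
Lemma density1_meets U x (c : R) :
  lebesgue_outer.-cara.-measurable U -> density1 U x -> 0 < c ->
  \forall r \near 0^'+, forall S, S `<=` eball x r ->
    (c%:E * outer (eball x r) <= outer S)%E -> outer (S `&` U) <> 0%E.
Proof.
move=> mU dU c0.
have nearU : \forall r \near 0^'+,
    ((1 - c)%:E < outer (U `&` eball x r) / outer (eball x r))%E.
  apply: (dU [set y | (1 - c)%:E < y]%E); apply: open_nbhs_nbhs; split.
    exact: open_ereal_gt_ereal.
  by rewrite /= lte_fin; lra.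
near=> r => S SB cS SU0.
have r0 : 0 < r by near: r; exact: nbhs_right_gt.
have : ((1 - c)%:E < outer (U `&` eball x r) / outer (eball x r))%E by near: r.
have := lebesgue_outer_eball_gt0 x _ r0.
have q_fin := lebesgue_outer_eball_fin_num x r.
have : (outer S <= outer (eball x r `&` ~` U))%E.
  have SE : S `<=` (eball x r `&` ~` U) `|` (S `&` U).
    by move=> y Sy; have [Uy|Uy] := pselect (U y); [right|left; split => //; exact: SB].
  apply: le_trans (le_lebesgue_outer SE) _.
  by rewrite lebesgue_outer_setU_null.
move=> /(le_trans cS).
have : outer (eball x r) =
    (outer (U `&` eball x r) + outer (eball x r `&` ~` U))%E.
  by rewrite (setIC U); exact: mU.
move: q_fin.
have := lebesgue_outer_ge0 (U `&` eball x r).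
have := lebesgue_outer_ge0 (eball x r `&` ~` U).
case: (outer (eball x r)) => // q.
case: (outer (eball x r `&` ~` U)) => [s| |]//; case: (outer (U `&` eball x r)) => [p| |]//.
move=> _ _ _; rewrite -EFinD => -[->] {q}; rewrite -EFinM lee_fin lte_fin => cs q0.
rewrite inver gt_eqF//.
rewrite -EFinM lte_fin ltr_pdivlMr//; lra.
Unshelve. all: by end_near. Qed.

End Balls.

(** * Convex sets and convex functions *)
Section ConvexSets.
Context {R : realType}.

Lemma convex_set_comb (E : lmodType R) (A : set E) (x y : E) (t : R) :
  convex_set A -> 0 <= t <= 1 -> A x -> A y -> A (t *: x + (1 - t) *: y).
Proof.
move=> cA /andP[t0 t1] Ax Ay.
by have := cA x y (Itv01 t0 t1); rewrite !inE; apply.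
Qed.

Lemma convex_set_intro (E : lmodType R) (A : set E) :
  (forall x y (t : R), 0 <= t <= 1 -> A x -> A y -> A (t *: x + (1 - t) *: y)) ->
  convex_set A.
Proof.
move=> cA x y t; rewrite !inE => Ax Ay; apply: cA => //.
by apply/andP; split.
Qed.

Context {N : nat}.
Local Notation V := 'rV[R]_N.
Implicit Types (f : V -> \bar R) (C : set V) (c : V).

Lemma convex_efun_le f (x y : V) (s u t : R) : convex_efun f -> 0 <= t <= 1 ->
  (f x <= s%:E)%E -> (f y <= u%:E)%E ->
  (f (t *: x + (1 - t) *: y)%R <= (t * s + (1 - t) * u)%:E)%E.
Proof. by move=> cf t01 fx fy; have := convex_set_comb _ _ (x, s) (y, u) t cf t01 fx fy. Qed.

(** The epigraph has no point at height [-oo]; for [a = -oo] the bound [f <= r]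
    is carried over for every real [r] instead. *)
Lemma convex_sublevel f (a : \bar R) :
  convex_efun f -> convex_set [set x | f x <= a]%E.
Proof.
move=> cf; apply: convex_set_intro => x y t t01; case: a => [a| |]/=.
- move=> fx fy; have := convex_efun_le _ _ _ _ _ _ cf t01 fx fy.
  by rewrite -mulrDl (addrC t) subrK mul1r.
- by rewrite !leey.
- rewrite !leeNy_eq => /eqP fx /eqP fy.
  have fle r : (f (t *: x + (1 - t) *: y)%R <= r%:E)%E.
    have := @convex_efun_le f x y r r t cf t01; rewrite fx fy !leNye => /(_ isT isT).
    by rewrite -mulrDl (addrC t) subrK mul1r.
  case: (f _) fle => [r fle|/(_ 0)//|//].
  by have := fle (r - 1); rewrite lee_fin; lra.
Qed.

Lemma convex_edom f : convex_efun f -> convex_set (edom f).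
Proof.
move=> cf; apply: convex_set_intro => x y t t01 fx fy.
have cmax := convex_sublevel f (Order.max (f x) (f y)) cf.
apply: (@le_lt_trans _ _ (Order.max (f x) (f y))).
  by apply: (convex_set_comb _ _ x y t cmax t01); rewrite /= le_max lexx ?orbT.
by rewrite gt_max; apply/andP.
Qed.

(** The scale [s] makes the induction go through: after the first weight is
    split off, what remains is a combination of total weight less than
    [s - l ord0], and the two parts combine convexly.  The strict inequality
    avoids a division by zero. *)
Lemma convex_set_simplex C c n (p : 'I_n -> V) (l : 'I_n -> R) (s : R) :
  convex_set C -> C c -> (forall i, C (p i)) ->
  (forall i, 0 <= l i) -> \sum_i l i < s ->
  exists2 d, C d & \sum_i l i *: (p i - c) = s *: (d - c).
Proof.
move=> cC Cc; elim: n p l s => [|n IHn] p l s Cp l0.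
  by move=> _; exists c => //; rewrite big_ord0 subrr scaler0.
rewrite !big_ord_recl/= => ls.
have [|d Cd ->] := IHn (fun i => p (lift ord0 i)) (fun i => l (lift ord0 i))
  (s - l ord0) (fun i => Cp _) (fun i => l0 _); first by lra.
have := l0 ord0; have : 0 <= \sum_(i < n) l (lift ord0 i) by exact: sumr_ge0.
set a := l ord0 in ls *; set b := \sum_(i < n) _ in ls *; move=> b0 a0.
have s0 : 0 < s by lra.
exists ((a / s) *: p ord0 + (1 - a / s) *: d).
  apply: (convex_set_comb _ _ (p ord0) d _ cC) => //.
  by rewrite divr_ge0 ?(ltW s0)//= ler_pdivrMr//; lra.
by apply/rowP => k; rewrite !mxE; field; rewrite gt_eqF.
Qed.

(** As long as the set lies in no hyperplane, a free family of fewer than [N]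
    vectors [q - c], for points [q] of the set, can be enlarged: the family is
    killed by some linear form [a], and the set has a point at which [a] differs
    from its value at [c]. *)
Lemma hyperplane_or_frame C c : C c ->
  (exists a : 'cV[R]_N, a != 0 /\
    C `<=` [set x | (x *m a) ord0 ord0 = (c *m a) ord0 ord0]) \/
  (exists M : 'M[R]_N, M \in unitmx /\ forall i, C (c + row i M)).
Proof.
move=> Cc; have [|nohyp] := pselect (exists a : 'cV[R]_N, a != 0 /\
    C `<=` [set x | (x *m a) ord0 ord0 = (c *m a) ord0 ord0]); first by left.
right; suff : forall r, (r <= N)%N ->
    exists M : 'M[R]_(r, N), row_free M /\ forall i, C (c + row i M).
  move=> /(_ N (leqnn N))[M [Mfree CM]]; exists M.
  by rewrite -row_free_unit.
elim=> [_|r IHr rN]; first by exists 0; split; [rewrite /row_free mxrank0|case].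
have [M [Mfree CM]] := IHr (ltnW rN).
have [i [j Kij]] : exists i j, cokermx M i j != 0.
  apply/matrix0Pn; rewrite -mxrank_eq0 mxrank_coker.
  by rewrite (eqP Mfree) subn_eq0 -ltnNge.
pose a : 'cV[R]_N := col j (cokermx M).
have a0 : a != 0 by apply/cV0Pn; exists i; rewrite mxE.
have Ma : M *m a = 0 by rewrite /a colE mulmxA mulmx_coker mul0mx.
have [x Cx xa] : exists2 x, C x & (x *m a) ord0 ord0 != (c *m a) ord0 ord0.
  apply: contrapT => nox; apply: nohyp; exists a; split => // x Cx /=.
  by apply/eqP; apply: contrapT => /negP xa; apply: nox; exists x.
pose v := x - c.
have va : (v *m a) ord0 ord0 != 0 by rewrite mulmxBl !mxE subr_eq0; move: xa; rewrite !mxE.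
exists (col_mx v M : 'M[R]_(1 + r, N)); split.
  apply: (@inj_row_free _ (1 + r) N) => u; rewrite -[u](@hsubmxK _ 1 1 r) mul_row_col => uvM.
  have l0 : lsubmx u = 0.
    have := congr1 (mulmx^~ a) uvM; rewrite /= mulmxDl -!mulmxA Ma mulmx0 addr0 mul0mx.
    move=> /(congr1 (fun A : 'M[R]_1 => A ord0 ord0)); rewrite mxE big_ord1 [RHS]mxE => /eqP.
    rewrite mulf_eq0 (negPf va) orbF => /eqP l00.
    by apply/rowP => k; rewrite ord1 l00 mxE.
  move: uvM; rewrite l0 mul0mx add0r => /eqP; rewrite (mulmx_free_eq0 _ Mfree).
  by move=> /eqP ->; rewrite row_mx0.
suff : forall k : 'I_(1 + r), C (c + row k (col_mx v M)) by [].
move=> k; case: (split_ordP k) => {}k ->.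
  rewrite rowKu (_ : row k v = v); last by apply/rowP => k'; rewrite mxE ord1.
  by rewrite /v addrC subrK.
by rewrite rowKd.
Qed.

Let continuous_linear (b : 'cV[R]_N) : continuous (fun x : V => (x *m b) ord0 ord0).
Proof.
move=> p; rewrite (_ : (fun x : V => _) = fun x => \sum_i x ord0 i * b i ord0); last first.
  by apply/funext => x; rewrite mxE.
apply: (@cvg_big _ _ _ 0 _ _ _ (nbhs p)) => [|i _]; first exact: add_continuous.
by apply: cvgMl; exact: coord_continuous.
Qed.

(** The points [c] and [c + row i M] are the vertices of a nondegenerate
    simplex.  Its interior is described by strict inequalities between
    continuous functions, the barycentric coordinates. *)
Lemma convex_set_frame_interior C c (M : 'M[R]_N) :
  convex_set C -> C c -> M \in unitmx -> (forall i, C (c + row i M)) ->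
  C° !=set0.
Proof.
move=> cC Cc Mu CM.
pose b i : 'cV[R]_N := invmx M *m delta_mx i ord0.
pose s : 'cV[R]_N := invmx M *m const_mx 1.
pose m : V := const_mx N.+1%:R^-1.
pose p : V := c + m *m M.
have coordE x i : ((x - c) *m invmx M) ord0 i = (x *m b i) ord0 ord0 - (c *m b i) ord0 ord0.
  by rewrite /b !mulmxA -!colE mulmxBl !mxE.
have sumE x : \sum_i ((x - c) *m invmx M) ord0 i = (x *m s) ord0 ord0 - (c *m s) ord0 ord0.
  transitivity (((x - c) *m invmx M *m (const_mx 1 : 'cV[R]_N)) ord0 ord0).
    by rewrite mxE; apply: eq_bigr => i _; rewrite [X in _ = _ * X]mxE mulr1.
  by rewrite -mulmxA mulmxBl !mxE.
have pc : (p - c) *m invmx M = m by rewrite /p addrC addKr mulmxK.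
exists p; rewrite /interior/=.
have gt_b : \forall x \near p, forall i, (c *m b i) ord0 ord0 < (x *m b i) ord0 ord0.
  apply: (@filter_forall V 'I_N
    (fun i x => (c *m b i) ord0 ord0 < (x *m b i) ord0 ord0) (nbhs p)) => i.
  apply: (cvgr_gt _ (continuous_linear (b i) p)).
  by rewrite -subr_gt0 -coordE pc mxE invr_gt0 ltr0n.
have lt_s : \forall x \near p, (x *m s) ord0 ord0 < 1 + (c *m s) ord0 ord0.
  apply: (cvgr_lt _ (continuous_linear s p)).
  rewrite -ltrBlDr -sumE pc; under eq_bigr do rewrite mxE.
  by rewrite sumr_const card_ord -[ltLHS]mulr_natl ltr_pdivrMr ?ltr0n// mul1r ltr_nat.
near=> x.
have [||d Cd] := @convex_set_simplex C c N (fun i => c + row i M)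
  (fun i => ((x - c) *m invmx M) ord0 i) 1 cC Cc CM.
- move=> i; rewrite coordE subr_ge0 ltW//.
  by move: i; near: x.
- by rewrite sumE ltrBlDr; near: x.
rewrite scale1r (eq_bigr (fun i => ((x - c) *m invmx M) ord0 i *: row i M)); last first.
  by move=> i _; congr (_ *: _); rewrite addrC addKr.
by rewrite -mulmx_sum_row mulmxKV// => /addIr ->.
Unshelve. all: by end_near. Qed.

Lemma convex_set_null C :
  convex_set C -> C° = set0 -> lebesgue_outer C = 0%E.
Proof.
move=> cC C0; have [[c Cc]|] := pselect (C !=set0); last first.
  by move=> /nonemptyPn ->; exact: lebesgue_outer0.
have [[a [a0 Ca]]|[M [Mu CM]]] := hyperplane_or_frame C c Cc.
  exact: lebesgue_outer_subset_null Ca (lebesgue_outer_hyperplane _ _ a0).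
by have := convex_set_frame_interior C c M cC Cc Mu CM; rewrite C0 => -[].
Qed.

Lemma lebesgue_outer_gt0_interior C : C° !=set0 -> (0 < lebesgue_outer C)%E.
Proof.
move=> [x /nbhs_ballP[e /= e0 xeC]].
have e20 : 0 < e / 2 by rewrite divr_gt0.
apply: lt_le_trans (lebesgue_outer_cube_gt0 x _ e20) _.
apply: le_lebesgue_outer => y yx; apply: xeC; split => // i j.
rewrite ord1 /ball/=; have := yx j; rewrite !mxE => /andP[y1 y2].
by rewrite ltr_norml; lra.
Qed.

End ConvexSets.

(** * Values of convex functions at density points *)
Section DensityPoints.
Context {R : realType} {N : nat}.
Local Notation V := 'rV[R]_N.
Local Notation outer := (@lebesgue_outer R N).
Local Notation mu := (@lebesgue_mu R N).
Local Notation L := (caratheodory_type (@lebesgue_outer R N)).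
Implicit Types (f : V -> \bar R) (C U Z : set V) (x : V).

(** The exceptional set is its own measurable cover: the measure is complete,
    so that a set of outer measure zero is measurable. *)
Lemma ae_lebesgueE (P : V -> Prop) :
  {ae mu, forall x : L, P x} <-> outer [set x | ~ P x] = 0%E.
Proof.
split => [[A [mA A0 PA]]|P0]; first exact: lebesgue_outer_subset_null PA A0.
exists [set x | ~ P x]; split => //.
apply: le_caratheodory_measurable => X.
rewrite [X in (X + _)%E](_ : _ = 0%E).
  by rewrite add0e; apply: le_lebesgue_outer; exact: subIsetl.
by apply: lebesgue_outer_subset_null P0; exact: subIsetr.
Qed.

(** Both [U] and its reflection through [x] fill more than half of a small ball,
    so that they share a point off [Z] whose mirror image is off [Z] too. *)
Lemma convex_set_density_point C U Z x :
  convex_set C -> lebesgue_outer.-cara.-measurable U -> density1 U x ->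
  outer Z = 0%E -> U `\` Z `<=` C -> C x.
Proof.
move=> cC mU dU Z0 UZC.
near (at_right (0 : R)) => r.
have r0 : 0 < r by near: r; exact: nbhs_right_gt.
have half0 : 0 < 2^-1 :> R by rewrite invr_gt0.
have meets : forall S, S `<=` eball x r ->
    (2^-1%:E * outer (eball x r) <= outer S)%E -> outer (S `&` U) <> 0%E.
  by near: r; exact: density1_meets.
pose W := (U `&` eball x r) `\` Z.
have outerW : (2^-1%:E * outer (eball x r) <= outer W)%E.
  have BW : (outer (U `&` eball x r) <= outer W)%E.
    rewrite -(lebesgue_outer_setU_null W Z Z0); apply: le_lebesgue_outer => y Uy.
    by have [Zy|Zy] := pselect (Z y); [right|left].
  apply: le_trans BW; rewrite leNgt; apply/negP => Ulow.
  (* If [U] filled less than half of the ball, its complement, which misses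
     [U], would fill more than half of it. *)
  apply: (meets (eball x r `&` ~` U)).
  - exact: subIsetl.
  - have : outer (eball x r) =
        (outer (U `&` eball x r) + outer (eball x r `&` ~` U))%E.
      by rewrite (setIC U); exact: mU.
    move: (lebesgue_outer_eball_fin_num x r) Ulow.
    have := lebesgue_outer_ge0 (U `&` eball x r).
    case: (outer (eball x r)) => // q.
    case: (outer (eball x r `&` ~` U)) => [b| |]//; case: (outer (U `&` eball x r)) => [a| |]//.
    move=> _ _; rewrite -EFinM lte_fin => aq; rewrite -EFinD => -[qE].
    by rewrite lee_fin; lra.
  - by rewrite -setIA setICl setI0 lebesgue_outer0.
pose S := [set (x *+ 2 - z)%R | z in W].
have SB : S `<=` eball x r.
  move=> _ [z [[_ /(eballP r0) zB] _] <-]; apply/(eballP r0); move: zB.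
  rewrite (eq_bigr (fun i => ((x *+ 2 - z) ord0 i - x ord0 i) ^+ 2))// => i _.
  by rewrite !mxE; ring.
have SU : outer (S `&` U) <> 0%E by apply: meets => //; rewrite lebesgue_outer_reflect.
have [z [[[z' [[Uz' _] Zz'] zz'] Uz] Zz]] : (S `&` U) `\` Z !=set0.
  apply: contrapT => noz; apply: SU; apply: lebesgue_outer_subset_null Z0.
  by move=> y SUy; apply: contrapT => Zy; apply: noz; exists y.
have -> : x = 2^-1 *: z + (1 - 2^-1) *: z'.
  by rewrite -zz'; apply/rowP => i; rewrite !mxE; field.
apply: (convex_set_comb _ _ z z' 2^-1 cC) => //; first lra.
- exact: UZC.
- exact: UZC.
Unshelve. all: by end_near. Qed.

(** The set [dom f] is the union of the bounded sets [A n], on which [f] is at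
    most [n], so that one of them has positive measure.  Its image under the
    homothety with centre [x] and ratio [t] is contained in [f < y] as soon as
    [t n + (1 - t) s0 < s], where [f x <= s0 < s <= y]; and it fills the same
    proportion [c] of the ball of radius [t K] for every [t]. *)
Lemma convex_sublevel_density_point f U x (y : \bar R) :
  convex_efun f -> outer (edom f) <> 0%E ->
  lebesgue_outer.-cara.-measurable U -> density1 U x ->
  (f x < y)%E -> outer (U `&` [set z | f z < y]%E) <> 0%E.
Proof.
move=> cf dom0 mU dU fxy.
have [s0 [s [fs0 s0s sy]]] : exists s0 s : R, [/\ (f x <= s0%:E)%E, s0 < s & (s%:E <= y)%E].
  case: (f x) y fxy => [a| |] [b| |]//.
  - by rewrite lte_fin => ab; exists a, b.
  - by move=> _; exists a, (a + 1); split; rewrite ?leey//; lra.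
  - by move=> _; exists (b - 1), b; split; rewrite ?leNye//; lra.
  - by move=> _; exists 0, 1; split; rewrite ?leNye ?leey.
pose A (n : nat) := [set z | f z <= n%:R%:E]%E `&` eball x n.+1%:R.
have [n An0] : exists n, outer (A n) <> 0%E.
  apply: contrapT => noA; apply: dom0.
  suff domA : edom f `<=` \bigcup_n A n.
    apply: lebesgue_outer_subset_null domA _; apply: lebesgue_outer_null_bigcup => n.
    by apply: contrapT => An0; apply: noA; exists n.
  move=> z; rewrite /edom/= => fz.
  have [a fza] : exists a : R, (f z <= a%:E)%E.
    case: (f z) fz => [a| |]//; first by exists a.
    by exists 0; rewrite leNye.
  pose d := Num.sqrt (\sum_(i < N) (z ord0 i - x ord0 i) ^+ 2).
  pose n := Num.truncn (`|a| + d).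
  have nad : `|a| + d < n.+1%:R by rewrite truncnS_gt.
  have d0 : 0 <= d by exact: sqrtr_ge0.
  exists n.+1 => //; split.
    apply: le_trans fza _; rewrite lee_fin; have := ler_norm a; lra.
  by rewrite /eball/= -/d -natr1; have := normr_ge0 a; lra.
set K : R := n.+1%:R.
have K0 : 0 < K by rewrite ltr0n.
pose c := fine (outer (A n)) / fine (outer (eball x K)).
have An_le : (outer (A n) <= outer (eball x K))%E.
  by apply: le_lebesgue_outer; exact: subIsetr.
have An_fin : outer (A n) \is a fin_num.
  by rewrite ge0_fin_numE ?lebesgue_outer_ge0// (le_lt_trans An_le)// lebesgue_outer_eball_lty.
have An_gt0 : (0 < outer (A n))%E.
  by rewrite lt_def lebesgue_outer_ge0 andbT; exact/eqP.
have B_gt0 := lt_le_trans An_gt0 An_le.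
have B_fin := lebesgue_outer_eball_fin_num x K.
have cE : (c%:E * outer (eball x K) = outer (A n))%E.
  rewrite -(fineK An_fin) -(fineK B_fin) -EFinM /c divfK//.
  by rewrite gt_eqF// fine_gt0// B_gt0 ltey_eq B_fin.
have c0 : 0 < c.
  by rewrite divr_gt0// fine_gt0// ?An_gt0 ?B_gt0 ltey_eq ?An_fin ?B_fin.
(* The summand 1 keeps the denominator [D] positive. *)
pose D : R := `|n%:R - s0| + 1.
have D0 : 0 < D by rewrite ltr_wpDl.
pose t0 := Num.min 1 ((s - s0) / D).
have t00 : 0 < t0 by rewrite lt_min ltr01 divr_gt0// subr_gt0.
near (at_right (0 : R)) => r.
have r0 : 0 < r by near: r; exact: nbhs_right_gt.
have rt0 : r < t0 * K by near: r; apply: nbhs_right_lt; exact: mulr_gt0.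
pose t := r / K.
have t_gt0 : 0 < t by rewrite divr_gt0.
have rE : r = t * K by rewrite /t divfK// gt_eqF.
have tt0 : t < t0 by move: rt0; rewrite rE ltr_pM2r.
have /andP[t1 tD] : (t < 1) && (t < (s - s0) / D) by rewrite -lt_min.
pose S := [set ((x - t *: x) + t *: z)%R | z in A n].
have SB : S `<=` eball x r.
  rewrite rE eball_scale// => _ [z [_ zB] <-]; by exists z.
have Sc : (c%:E * outer (eball x r) <= outer S)%E.
  by rewrite rE lebesgue_outer_eball_scale// lebesgue_outer_affine// muleCA cE.
have meets : outer (S `&` U) <> 0%E.
  by move: (S) SB Sc; near: r; exact: density1_meets.
move=> U0; apply: meets; apply: lebesgue_outer_subset_null U0.
move=> _ [[z [fz _] <-] Uz]; split => //=; apply: lt_le_trans sy.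
have -> : x - t *: x + t *: z = t *: z + (1 - t) *: x.
  by apply/rowP => i; rewrite !mxE; ring.
have t01 : 0 <= t <= 1 by rewrite !ltW.
apply: le_lt_trans (convex_efun_le _ _ _ _ _ _ cf t01 fz fs0) _.
rewrite lte_fin; move: tD; rewrite ltr_pdivlMr//.
have : t * (n%:R - s0) <= t * D.
  by rewrite ler_pM2l// /D; have := ler_norm (n%:R - s0 : R); lra.
by rewrite mulrBr; lra.
Unshelve. all: by end_near. Qed.

Lemma density_openT : density_open [set: V].
Proof.
right; split => [|x _]; first exact: measurableT.
apply: cvg_near_cst; near=> r.
have r0 : 0 < r by near: r; exact: nbhs_right_gt.
have := lebesgue_outer_eball_gt0 x _ r0; have := lebesgue_outer_eball_fin_num x r.
rewrite setTI /lebesgue_mu; case: (outer (eball x r)) => // q _; rewrite lte_fin => q0.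
by rewrite inver gt_eqF// -EFinM divff// gt_eqF.
Unshelve. all: by end_near. Qed.

End DensityPoints.

Theorem corollary4 (R : realType) (N : nat) (f : 'rV[R]_N -> \bar R)
    (hf : convex_efun f) :
  (forall U : set 'rV[R]_N, density_open U ->
     ereal_sup (f @` U) = ess_sup_on U f)
  /\
  ((forall U : set 'rV[R]_N, density_open U ->
      ereal_inf (f @` U) = ess_inf_on U f)
   <->
   ((forall x, f x = +oo%E) \/ (edom f)° !=set0)).
Proof.
have aeT (P : 'rV[R]_N -> Prop) : (forall x, P x) ->
    lebesgue_outer [set x | ~ P x] = 0%E.
  move=> allP; rewrite (_ : [set x | _] = set0) ?lebesgue_outer0//.
  by apply/seteqP; split => // x; exact.
split=> [U dU|].
  apply/eqP; rewrite eq_le; apply/andP; split; last first.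
    apply: ereal_inf_lbound; apply/ae_lebesgueE/aeT => x Ux.
    by apply: ereal_sup_ubound; exists x.
  apply: le_ereal_inf_tmp => y /= /ae_lebesgueE Z0; apply: ge_ereal_sup => _ [x Ux <-].
  case: dU => [U0|[mU dU]]; first by rewrite U0 in Ux.
  apply: (convex_set_density_point [set z | f z <= y]%E U _ x _ mU (dU x Ux) Z0).
    exact: convex_sublevel.
  by move=> z [Uz /contrapT]; exact.
split=> [infE|].
  have [finf|] := pselect (forall x, f x = +oo%E); first by left.
  move=> /existsNP[x0 fx0]; right; apply: contrapT => /nonemptyPn/convex_set_null dom0.
  have := infE _ density_openT; apply/eqP; rewrite lt_eqF//.
  apply: (@le_lt_trans _ _ (f x0)); first by apply: ereal_inf_lbound; exists x0.
  rewrite (_ : ess_inf_on _ _ = +oo%E); first by rewrite ltey; exact/eqP.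
  apply/eqP; rewrite -leye_eq; apply: ereal_sup_ubound; apply/ae_lebesgueE.
  apply: lebesgue_outer_subset_null (dom0 (convex_edom f hf)) => x /=.
  by move=> /not_implyP[_]; rewrite leye_eq /edom/= ltey => /negP.
move=> finf U dU; apply/eqP; rewrite eq_le; apply/andP; split.
  apply: ereal_sup_ubound; apply/ae_lebesgueE/aeT => x Ux.
  by apply: ereal_inf_lbound; exists x.
apply: ge_ereal_sup => y /= /ae_lebesgueE Z0; apply: le_ereal_inf_tmp => _ [x Ux <-].
case: finf => [->|dom_int]; first by rewrite leey.
case: dU => [U0|[mU dU]]; first by rewrite U0 in Ux.
rewrite leNgt; apply/negP => fxy.
have dom0 : lebesgue_outer (edom f) <> 0%E.
  by move=> dom0; have := lebesgue_outer_gt0_interior _ dom_int; rewrite dom0 ltxx.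
apply: (convex_sublevel_density_point f U x y hf dom0 mU (dU x Ux) fxy).
apply: lebesgue_outer_subset_null Z0 => z [Uz /= fzy] /(_ Uz).
by rewrite leNgt fzy.
Qed.
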